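(* There exists an adversarial strategy making $O(n)$ queries such that, for any deterministic $k$-adaptive filter $\mathcal F$ on $n$ elements with false positive rate $\epsilon$, with $k<\log n/(6\log\log n)$ and $\epsilon>1/(n^{1/k})$, the adversary wins the adaptivity game with probability $\Omega(1)$.
   Context: Logarithms are base 2; asymptotics are as $n\to\infty$. The filter stores a set $S=\{x_1,\ldots,x_n\}$ from a large universe $U$ ($|U|\gg n$). The filter answers ''present'' or ''absent'' to queries; a query $q\notin S$ answered ''present'' is a false positive. A deterministic $k$-adaptive filter $\mathcal F$ on $n$ elements with false positive rate $\epsilon$ is a filter satisfying the following. (1) $\mathcal F$ has access to $k$ uniform random hash functions $h_0,\ldots,h_{k-1}$ on $U$. Each hash has length at most $\log(N/\epsilon)$ bits, for some $N=O(n/k)$ with $N\ge n/k$. (2) For every configuration $C$ of $\mathcal F$, each $x_i\in S$ is stored using at least one hash $h_{C[i]}(x_i)$, $0\le C[i]\le k-1$. (3) The filter answers ''present'' to a query $q$ on configuration $C$ if there exists an $x_i\in S$ such that $h_{C[i]}(q)=h_{C[i]}(x_i)$ (then $q$ is said to collide with $x_i$). Otherwise it answers ''absent''. (4) On a false positive $q$, $\mathcal F$ updates $C$ to a new configuration $C'$ in round-robin order: if $q$ collides with an element $x_i\in S$ stored using $h_\beta$, then $x_i$ is stored in $C'$ using $h_{\beta'}$ with $\beta'=\beta+1\pmod k$. Adaptivity game: an adversary generates a sequence of queries. After each query $q$, both the adversary and the filter learn whether $q$ was a false positive; the filter may change its internal representation in response, and the adversary may use this information to choose later queries. At any time the adversary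 may name a special element $\hat q$; the adversary wins if $\hat q$ is a false positive at that time, and the filter wins otherwise. *)

(* Defs.v *)
From mathcomp Require Import all_boot all_order all_algebra.
From mathcomp Require Import all_reals exp.

Set Implicit Arguments.
Unset Strict Implicit.
Unset Printing Implicit Defensive.

Import Order.TTheory GRing.Theory Num.Theory.
Local Open Scope ring_scope.

Definition log2 (R : realType) (a : R) : R := ln a / ln 2.

(* One uniform random function U -> {0,1}^(len b) for each index b; distinct
   indices may have distinct hash lengths. *)
Definition hash_family (U : finType) (k : nat) (len : 'I_k -> nat) :=
  {dffun forall b : 'I_k, {ffun U -> (len b).-tuple bool}}.

(* C i is the index of the hash function currently used to store x_i. *)
Definition configuration (n k : nat) := {ffun 'I_n -> 'I_k}.

(* The constant c is the one hidden in N = O(n/k).  The configuration before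
   the first query is an arbitrary deterministic function of the stored
   elements and of their hash values. *)
Record adaptive_filter (R : realType) (c : R) (U : finType) (n k : nat)
    (eps : R) := AdaptiveFilter {
  range_param : R;
  range_param_ge : n%:R / k%:R <= range_param;
  range_param_le : range_param <= c * (n%:R / k%:R);
  hash_len : 'I_k -> nat;
  hash_len_le : forall b, (hash_len b)%:R <= log2 (range_param / eps);
  init_config : ('I_n -> U) ->
    (forall b : 'I_k, 'I_n -> (hash_len b).-tuple bool) -> configuration n k
}.

Arguments init_config {R c U n k eps} _ _ _.

(* The stored set S is given by an enumeration x of its n elements. *)
Section Semantics.
Variables (U : finType) (n k : nat) (len : 'I_k -> nat).
Variables (h : hash_family U len) (x : 'I_n -> U).
Implicit Types (C : configuration n k) (q : U).

Definition collides C q (i : 'I_n) : bool := h (C i) q == h (C i) (x i).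

Definition present C q : bool := [exists i, collides C q i].

Definition false_positive C q : bool :=
  [forall i, q != x i] && present C q.

(* ordS is the cyclic successor b |-> b + 1 mod k. *)
Definition round_robin C q : configuration n k :=
  [ffun i => if collides C q i then ordS (C i) else C i].

Definition next_config C q : configuration n k :=
  if false_positive C q then round_robin C q else C.

End Semantics.

(* A deterministic strategy is a decision tree: the branch taken after a query
   is determined by whether that query was a false positive; a leaf names the
   special element. *)
Inductive strategy (U : Type) : Type :=
| Name of U
| Query of U & (bool -> strategy U).

(* Worst case over all answers. *)
Fixpoint num_queries (U : Type) (s : strategy U) : nat :=
  match s with
  | Name _ => 0
  | Query _ next => (maxn (num_queries (next true)) (num_queries (next false))).+1
  end.

Fixpoint wins (U : finType) (n k : nat) (len : 'I_k -> nat)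
    (h : hash_family U len) (x : 'I_n -> U) (C : configuration n k)
    (s : strategy U) : bool :=
  match s with
  | Name q => false_positive h x C q
  | Query q next =>
      wins h x (next_config h x C q) (next (false_positive h x C q))
  end.

(* A randomized strategy draws its coins uniformly from a finite type. *)
Record adversary (U : Type) := Adversary {
  coins : finType;
  play : coins -> strategy U
}.

Definition adversary_wins (R : realType) (c : R) (U : finType) (n k : nat)
    (eps : R) (A : adversary U) (F : adaptive_filter c U n k eps)
    (x : 'I_n -> U) (w : coins A) (h : hash_family U (hash_len F)) : bool :=
  wins h x (init_config F x (fun b i => h b (x i))) (play w).

(* Probability over independent uniform coins and hash functions. *)
Definition win_probability (R : realType) (c : R) (U : finType) (n k : nat)
    (eps : R) (A : adversary U) (F : adaptive_filter c U n k eps)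
    (x : 'I_n -> U) : R :=
  #|[set wh : coins A * hash_family U (hash_len F)
      | adversary_wins x wh.1 wh.2]|%:R
  / #|{: coins A * hash_family U (hash_len F)}|%:R.

(* Main.v *)
(* A stored element x_i that is hit by some query of a pool P under each of its k
   hash functions ("live for P") never stops moving while P is queried over and
   over; any other element gets stuck after at most k passes over P.  So a pass
   without false positives certifies that no element is live.  If some element is
   live for q_1, ..., q_(j+1) but none for q_1, ..., q_j, then after k passes over
   q_1, ..., q_j that element rests where only q_(j+1) can hit it, and q_(j+1) is
   a sure false positive.

   The adversary doubles the pool until it has a live element.  Since passes over
   a pool with no live element stop within k rounds, and a live element appears
   (with constant probability) at pool size m = O(n/k), the total cost is O(n)
   although k is unknown.  The critical index j is then found by bisection, which
   costs polylog(n) passes over a pool that must have size at most n/log^2 n.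
   If the pool is larger, it is replaced by the false positives of the next few
   passes, capped at that size; by pigeonhole these retain a live element unless
   there are too many live elements.  But many live elements at size m force, via
   k < log n / (6 log log n), a live element already in the first, small pool.

   For the probabilities, fix the hash values of the pool: the stored elements are
   then live independently of each other, with probability prod_b |h_b(P)| / R_b,
   whatever the initial configuration. *)
Require Import Defs.
From mathcomp Require Import all_boot all_order all_algebra.
From mathcomp Require Import all_reals exp.
From mathcomp Require Import zify ring lra.
Import Order.TTheory GRing.Theory Num.Theory.

Set Implicit Arguments.
Unset Strict Implicit.
Unset Printing Implicit Defensive.

(** * The dynamics of a pool *)

Section Dynamics.
Variables (I : finType) (U : eqType) (k : nat) (hit : I -> 'I_k -> U -> bool).
Implicit Types (i : I) (b : 'I_k) (C : {ffun I -> 'I_k}) (q : U) (s P : seq U).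

Definition step i b q : 'I_k := if hit i b q then ordS b else b.

Definition fp C q : bool := [exists i, hit i (C i) q].

Definition nxt C q : {ffun I -> 'I_k} := [ffun i => step i (C i) q].

Definition traj i b s := foldl (step i) b s.

Definition run C s := foldl nxt C s.

Fixpoint fps C s : seq U :=
  if s is q :: s' then nseq (fp C q) q ++ fps (nxt C q) s' else [::].

Fixpoint moves i b s : nat :=
  if s is q :: s' then hit i b q + moves i (step i b q) s' else 0.

Definition live P i : bool := [forall b, has (hit i b) P].

Definition rounds T P : seq U := flatten (nseq T P).

Lemma roundsS T P : rounds T.+1 P = P ++ rounds T P.
Proof. by []. Qed.

Lemma size_rounds T P : size (rounds T P) = T * size P.
Proof. by elim: T => // T IH; rewrite roundsS size_cat IH mulSn. Qed.

Lemma mem_rounds T P : {subset rounds T P <= P}.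
Proof.
by elim: T => // T IH q; rewrite roundsS mem_cat => /orP[//|/IH].
Qed.

Lemma runE C s i : run C s i = traj i (C i) s.
Proof. by elim: s C => //= q s IH C; rewrite IH ffunE. Qed.

Lemma run_cat C s1 s2 : run C (s1 ++ s2) = run (run C s1) s2.
Proof. exact: foldl_cat. Qed.

Lemma traj_cat i b s1 s2 : traj i b (s1 ++ s2) = traj i (traj i b s1) s2.
Proof. exact: foldl_cat. Qed.

Lemma moves_cat i b s1 s2 :
  moves i b (s1 ++ s2) = moves i b s1 + moves i (traj i b s1) s2.
Proof. by elim: s1 b => //= q s1 IH b; rewrite IH addnA. Qed.

Lemma stuck_moves i b s P : {subset s <= P} -> ~~ has (hit i b) P ->
  (moves i b s = 0) * (traj i b s = b).
Proof.
move=> sP nh; elim: s sP => //= q s IH sP.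
have qF : hit i b q = false.
  by apply: contraNF nh => hq; apply/hasP; exists q => //; apply: sP; rewrite mem_head.
by rewrite /step qF; apply: IH => x xs; apply: sP; rewrite inE xs orbT.
Qed.

(** The first query of [P] hitting [b] arrives while the element still rests at [b]. *)
Lemma moves_gt0 i b P : has (hit i b) P -> 0 < moves i b P.
Proof.
elim: P b => //= q P IH b; rewrite /step; case hq : (hit i b q) => //= h.
by rewrite IH.
Qed.

Lemma live_moves i b T P : live P i -> T <= moves i b (rounds T P).
Proof.
move=> /forallP l; elim: T b => // T IH b; rewrite roundsS moves_cat.
by have := moves_gt0 (l b); have := IH (traj i b P); lia.
Qed.

Lemma val_iter_ordS j b : val (iter j (@ordS k) b) = (b + j) %% k.
Proof.
elim: j => [|j IH]; first by rewrite addn0 modn_small.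
by rewrite iterS /= IH addnS -addn1 modnDml addn1.
Qed.

Lemma iter_ordS_onto b b' : exists2 j, j < k & iter j (@ordS k) b = b'.
Proof.
have [hb hb'] := (ltn_ord b, ltn_ord b').
exists ((b' + (k - b)) %% k); first by rewrite ltn_mod; lia.
apply: val_inj; rewrite val_iter_ordS modnDmr.
have -> : b + (b' + (k - b)) = b' + k by lia.
by rewrite modnDr modn_small.
Qed.

(** An index [b0] that [P] never hits is a barrier: the element cannot leave it, and each move
    brings it one step closer. The cyclic distance therefore bounds the number of moves. *)
Lemma distance_decreases i b b0 j s P : {subset s <= P} ->
  ~~ has (hit i b0) P -> iter j (@ordS k) b = b0 ->
  exists2 j', j' + (moves i b s) = j & iter j' (@ordS k) (traj i b s) = b0.
Proof.
move=> + nh; elim: s b j => [|q s IH] b j sP e.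
  by exists j; rewrite ?addn0.
have sP' : {subset s <= P} by move=> x xs; apply: sP; rewrite inE xs orbT.
rewrite /=; case hq : (hit i b q); last first.
  have -> : step i b q = b by rewrite /step hq.
  exact: IH.
have -> : step i b q = @ordS k b by rewrite /step hq.
case: j e => [/= e|j]; last first.
  by rewrite iterSr => /(IH _ _ sP')[j' <- e]; exists j' => //; lia.
by case/hasP: nh; exists q; [apply: sP; rewrite mem_head|rewrite -e].
Qed.

(** Each pass either finds the element stuck or shortens its distance to an unhit index, and that
    distance starts below [k]. *)
Lemma nonlive_stuck i b T P : ~~ live P i -> k <= T ->
  ~~ has (hit i (traj i b (rounds T P))) P.
Proof.
case/forallPn=> b0 nh kT; have [j jk e] := iter_ordS_onto b b0.
have {kT jk}jT : j <= T by lia.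
elim: T b j jT e => [|T IH] b j jT e.
  by case: j e jT => //= -> _.
rewrite roundsS traj_cat.
have [hb|nhb] := boolP (has (hit i b) P); last first.
  rewrite (stuck_moves (fun _ => id) nhb).
  by rewrite (stuck_moves (@mem_rounds T P) nhb).
have [j' e1 e2] := distance_decreases (fun _ => id) nh e.
by apply: (IH _ j') => //; have := moves_gt0 hb; lia.
Qed.

(** The query causing the next move after [j] moves collides at the index reached by then, and it is
    recorded as a false positive. *)
Lemma has_moved i C s j : j < moves i (C i) s ->
  has (hit i (iter j (@ordS k) (C i))) (fps C s).
Proof.
elim: s C j => //= q s IH C j; rewrite has_cat.
have nxtE : step i (C i) q = nxt C q i by rewrite ffunE.
case hq : (hit i (C i) q) => /= hj; last first.
  have -> : C i = nxt C q i by rewrite ffunE /step hq.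
  by rewrite [X in _ || X]IH ?orbT // -nxtE; lia.
have -> : fp C q by apply/existsP; exists i.
case: j hj => [|j] hj /=; first by rewrite hq.
rewrite -iterS iterSr; have -> : ordS (C i) = nxt C q i by rewrite ffunE /step hq.
by rewrite [X in _ || X]IH ?orbT // -nxtE; lia.
Qed.

(** Along [k] moves the element leaves every index once, each time because of a recorded query. *)
Lemma live_fps i C s : k <= moves i (C i) s -> live (fps C s) i.
Proof.
move=> km; apply/forallP => b; have [j jk <-] := iter_ordS_onto (C i) b.
by apply: has_moved; lia.
Qed.

Lemma size_fps C s : size (fps C s) <= \sum_i moves i (C i) s.
Proof.
elim: s C => [|q s IH] C //=; rewrite big_split size_cat size_nseq /=.
have -> : \sum_i moves i (step i (C i) q) s = \sum_i moves i (nxt C q i) s.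
  by apply: eq_bigr => i _; rewrite ffunE.
apply: leq_add (IH _); case: (boolP (fp C q)) => // /existsP[i hi].
by rewrite (bigD1 i) //= hi.
Qed.

(** Capping the list of false positives amounts to stopping the queries early, so move counts also
    apply to capped lists. *)
Lemma fps_prefix C s B : exists2 s', {subset s' <= s} & fps C s' = take B (fps C s).
Proof.
elim: s C B => [|q s IH] C B /=; first by exists [::] => //=; rewrite ?take_nil.
case: (boolP (fp C q)) => hq; last first.
  have [s' sub e] := IH (nxt C q) B.
  exists (q :: s') => [x|/=]; last by rewrite (negPf hq).
  by rewrite !inE => /orP[->//|/sub ->]; rewrite orbT.
case: B => [|B]; first by exists [::].
have [s' sub e] := IH (nxt C q) B.
exists (q :: s') => [x|/=]; last by rewrite hq e.
by rewrite !inE => /orP[->//|/sub ->]; rewrite orbT.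
Qed.

(* Each false positive moves a live element, so B of them force, by the
   pigeonhole principle, some live element through all k hash functions. *)
Lemma collect_live C T B P :
  (forall i, ~~ live P i -> ~~ has (hit i (C i)) P) -> k <= T ->
  (exists i, live P i) -> #|live P| * k <= B ->
  exists i, live (take B (fps C (rounds T P))) i.
Proof.
move=> stuck kT [i li] WB.
have [sz|sz] := leqP (size (fps C (rounds T P))) B.
  exists i; rewrite take_oversize //; apply: live_fps.
  by apply: leq_trans kT _; apply: live_moves.
have [s' sub e] := fps_prefix C (rounds T P) B.
have subP : {subset s' <= P} by move=> x /sub /mem_rounds.
have [/existsP[i' hi']|/existsPn nk] := boolP [exists i, k <= moves i (C i) s'].
  by exists i'; rewrite -e; apply: live_fps.
have := size_fps C s'; rewrite e size_takel ?(ltnW sz) // => Bsum.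
(* Elements that are not live never move, and the live ones stop short of [k] moves. This leaves
   fewer than [B] moves, too few for [B] false positives. *)
have Wsum : \sum_i moves i (C i) s' <= #|live P| * k.-1.
  rewrite -sum_nat_const [leqRHS]big_mkcond; apply: leq_sum => i' _.
  by case: ifPn => [_|/stuck /(stuck_moves subP) ->//]; have := nk i'; lia.
have W0 : 0 < #|live P| by apply/card_gt0P; exists i.
have k0 : 0 < k by have := ltn_ord (C i); lia.
have : #|live P| * k.-1 < #|live P| * k by rewrite ltn_pmul2l //; lia.
by move=> /leq_trans /(_ WB); rewrite ltnNge (leq_trans Bsum).
Qed.

Lemma fps_nil C P : fps C P = [::] -> forall i, ~~ has (hit i (C i)) P.
Proof.
move=> e i; apply/negP => /moves_gt0 /(has_moved).
by rewrite e.
Qed.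

Lemma stuck_fps C P : (forall i, ~~ has (hit i (C i)) P) -> fps C P = [::].
Proof.
move=> st; apply/nilP; rewrite /nilp -leqn0; apply: leq_trans (size_fps C P) _.
by rewrite big1 // => i _; rewrite (stuck_moves (fun _ => id) (st i)).
Qed.

(** The budget [a] concerns only the branch actually followed; [truncate] later turns it into a
    worst-case bound. *)
Fixpoint winsn (a : nat) C (s : strategy U) : bool :=
  match s with
  | Name q => fp C q
  | Query q next =>
      if a is a'.+1 then winsn a' (nxt C q) (next (fp C q)) else false
  end.

Lemma winsn_le a a' C (t : strategy U) : a <= a' -> winsn a C t -> winsn a' C t.
Proof.
elim: t a a' C => [q|q next IH] [|a] [|a'] C //=.
by rewrite ltnS; apply: IH.
Qed.

Fixpoint sweep (s acc : seq U) (cont : seq U -> strategy U) : strategy U :=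
  if s is q :: s' then
    Query q (fun r : bool => sweep s' (acc ++ nseq r q) cont)
  else cont acc.

Lemma winsn_sweep a C s acc cont :
  winsn a (run C s) (cont (acc ++ fps C s)) ->
  winsn (size s + a) C (sweep s acc cont).
Proof.
elim: s C acc => [|q s IH] C acc /=; first by rewrite cats0.
by move=> w; apply: IH; rewrite -catA.
Qed.

(** Invariant: no element is live for the first [lo] queries of [D], and some element is live for
    the first [lo + 2 ^ f]. A prefix is tested by [K] settling passes followed by one probing
    pass. *)
Fixpoint bisect (K f lo : nat) (q0 : U) (D : seq U) : strategy U :=
  if f is f'.+1 then
    let P := take (lo + 2 ^ f') D in
    sweep (rounds K P) [::] (fun _ => sweep P [::] (fun r =>
      if r is [::] then bisect K f' (lo + 2 ^ f') q0 D
      else bisect K f' lo q0 D))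
  else sweep (rounds K (take lo D)) [::] (fun _ => Name (nth q0 D lo)).

Lemma rounds_stuck K P C : k <= K -> (forall i, ~~ live P i) ->
  forall i, ~~ has (hit i (run C (rounds K P) i)) P.
Proof. by move=> kK nl i; rewrite runE nonlive_stuck. Qed.

(** After at least [k] settling passes, the probe is silent exactly when no element is live for the
    prefix. Liveness does not depend on the configuration, so testing does not disturb the
    invariant. *)
Lemma winsn_bisect K f lo q0 D C : k <= K ->
  (forall i, ~~ live (take lo D) i) ->
  (exists i, live (take (lo + 2 ^ f) D) i) ->
  winsn ((f * K.+1 + K) * size D) C (bisect K f lo q0 D).
Proof.
move=> kK; elim: f lo C => [|f IH] lo C nl [i li].
  apply: (@winsn_le (size (rounds K (take lo D)) + 0)).
    by rewrite addn0 size_rounds size_take; case: ltnP => ?; apply: leq_mul => //; lia.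
  apply: winsn_sweep => /=; set C' := run _ _.
  (* At width one, the element rests at an index missed by the first [lo] queries, so the query at
     position [lo], counted from zero, must hit it. *)
  move/forallP: li => /(_ (C' i)); rewrite expn0 addn1.
  have [loD|Dlo] := ltnP lo (size D); last first.
    rewrite !take_oversize; try lia.
    by move: (rounds_stuck C kK nl i); rewrite -/C' take_oversize // => /negPf ->.
  rewrite (take_nth q0 loD) -cats1 has_cat (negPf (rounds_stuck C kK nl i)) /= orbF.
  by move=> h; apply/existsP; exists i.
set P := take (lo + 2 ^ f) D.
have szP : size P <= size D by rewrite /P size_take; case: ltnP; lia.
apply: (@winsn_le (size (rounds K P) + (size P + (f * K.+1 + K) * size D))).
  rewrite size_rounds; have := leq_mul (leqnn K) szP; nia.
apply: winsn_sweep; apply: winsn_sweep; rewrite cat0s.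
set C'' := run (run _ _) _; set C' := run C _.
have [/existsP exl|/existsPn nl'] := boolP [exists i, live P i].
  case e : (fps C' P) => [|x r]; last exact: IH.
  case: exl => i' /forallP /(_ (C' i')).
  by rewrite (negPf (fps_nil e i')).
rewrite stuck_fps; last exact: rounds_stuck.
by apply: IH => //; exists i; rewrite -addnA addnn -mul2n -expnS.
Qed.

Fixpoint settle (T : nat) P (yes no : strategy U) : strategy U :=
  if T is T'.+1 then
    sweep P [::] (fun r => if r is [::] then no else settle T' P yes no)
  else yes.

(** A live element is hit in every pass, so no pass is silent and all [T] are performed. *)
Lemma winsn_settle_yes a T P yes no C : (exists i, live P i) ->
  winsn a (run C (rounds T P)) yes ->
  winsn (T * size P + a) C (settle T P yes no).
Proof.
move=> [i li]; elim: T C => [|T IH] C w //=.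
rewrite mulSn -addnA; apply: winsn_sweep; rewrite cat0s.
case e : (fps C P) => [|x r]; last by apply: IH; rewrite -run_cat.
by move/forallP: li => /(_ (C i)); rewrite (negPf (fps_nil e i)).
Qed.

(** After [k] passes everything is stuck, so pass [k.+1] is silent at the latest. An earlier pass
    may already be silent, hence [no] has to win from every configuration. *)
Lemma winsn_settle_no a T P yes no C : (forall i, ~~ live P i) -> k < T ->
  (forall C', winsn a C' no) ->
  winsn (k.+1 * size P + a) C (settle T P yes no).
Proof.
move=> nl kT w; rewrite -[T](subnKC kT); move: (T - _) => T' {kT T}.
have gen t C0 (s : seq U) : (forall i, ~~ has (hit i (run C0 (rounds t P) i)) P) ->
    winsn (t.+1 * size P + a) C0 (settle (t.+1 + T') P yes no).
  elim: t C0 => [|t IH] C0 st.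
    by rewrite /= mul1n; apply: winsn_sweep; rewrite stuck_fps //; apply: w.
  rewrite mulSn -addnA addSn /=; apply: winsn_sweep; rewrite cat0s.
  case: (fps C0 P) => [|x r]; last by apply: IH => i; rewrite -run_cat st.
  by apply: winsn_le (w _); lia.
by apply: (gen _ _ [::]) => i; apply: rounds_stuck.
Qed.

(** * Doubling stages and their query cost *)

Section Stages.
Variables (l : seq U) (q0 : U) (K B N : nat).

(* N is chosen so that N / m >= k for every size m up to the first one at which a
   live element is likely; up to there, outlasting patience means being live. *)
Definition patience m := (N %/ m).+1.

Definition endgame m : strategy U :=
  if m <= B then bisect K K.+1 0 q0 (take m l)
  else sweep (rounds (patience m) (take m l)) [::]
         (fun D => bisect K K.+1 0 q0 (take B D)).

Fixpoint stages (f m : nat) : strategy U :=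
  if f is f'.+1 then
    settle (patience m) (take m l) (endgame m) (stages f' m.*2)
  else Name q0.

Hypotheses (k_gt0 : 0 < k) (kK : k <= K) (BK : B < 2 ^ K.+1).

(** The empty prefix has no live element since [0 < k], and [B < 2 ^ K.+1] lets [K.+1] halvings
    reach width one. *)
Lemma winsn_bisect0 D C : size D <= B -> (exists i, live D i) ->
  winsn ((K.+1 * K.+1 + K) * B) C (bisect K K.+1 0 q0 D).
Proof.
move=> DB exl.
apply: (@winsn_le ((K.+1 * K.+1 + K) * size D)); first by rewrite leq_mul2l DB orbT.
apply: winsn_bisect => // [i|]; last by rewrite add0n take_oversize //; lia.
by rewrite take0; apply/forallPn; exists (Ordinal k_gt0).
Qed.

Lemma live_take m m' i : m <= m' -> live (take m l) i -> live (take m' l) i.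
Proof.
move=> mm' /forallP h; apply/forallP => b; have /hasP[q qm hq] := h b.
apply/hasP; exists q => //; move: qm; rewrite -(subnKC mm') takeD mem_cat => ->.
by [].
Qed.

Lemma size_take_le m : size (take m l) <= m.
Proof. by rewrite size_take; case: ltnP. Qed.

Lemma patience_mul m : patience m * m <= N + m.
Proof. by rewrite mulSn addnC leq_add2r leq_divM. Qed.

(** The live element may appear at a size [m] before the size [m'] for which the cap is known; since
    liveness grows with the pool, the cap passes down to [m]. Settling and collecting cost at most
    [2 * N] queries each. *)
Lemma winsn_settle_live m m' yes0 C : yes0 = endgame m -> forall no,
  0 < m -> m <= m' -> m' * k <= N ->
  (exists i, live (take m l) i) ->
  (m' <= B \/ #|live (take m' l)| * k <= B) ->
  winsn (4 * N + (K.+1 * K.+1 + K) * B) C (settle (patience m) (take m l) yes0 no).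
Proof.
move=> -> no m0 mm' m'N exl cap.
have mN : m <= N by nia.
have pat := patience_mul m.
have kpat : k <= patience m.
  by rewrite leqW // leq_divRL //; nia.
have Tm : patience m * size (take m l) <= 2 * N.
  have := leq_mul (leqnn (patience m)) (size_take_le m); lia.
apply: (@winsn_le (patience m * size (take m l) +
                   (2 * N + (K.+1 * K.+1 + K) * B))); first by lia.
apply: winsn_settle_yes => //; set C' := run _ _; rewrite /endgame.
case: leqP => [mB|Bm].
  apply: (@winsn_le ((K.+1 * K.+1 + K) * B)); first by lia.
  by apply: winsn_bisect0 => //; apply: leq_trans (size_take_le m) mB.
apply: (@winsn_le (size (rounds (patience m) (take m l)) +
                   (K.+1 * K.+1 + K) * B)); first by rewrite size_rounds; lia.
apply: winsn_sweep; rewrite cat0s; apply: winsn_bisect0.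
  by rewrite size_take; case: ltnP.
apply: collect_live => //.
  by move=> i nl; rewrite /C' runE; apply: nonlive_stuck.
case: cap => [m'B|]; first by lia.
apply: leq_trans; rewrite leq_mul2r; apply/orP; right.
by apply/subset_leq_card/subsetP => i; apply: live_take.
Qed.

(** A failed stage of size [m] costs at most [k.+1 * m <= 2 * k * m] queries, and the doubling sizes
    sum to [m * 2 ^ e - m]. *)
Lemma winsn_stages e f m C : e < f -> 0 < m -> m * 2 ^ e * k <= N ->
  (exists i, live (take (m * 2 ^ e) l) i) ->
  (m * 2 ^ e <= B \/ #|live (take (m * 2 ^ e) l)| * k <= B) ->
  winsn (2 * k * (m * 2 ^ e - m) + (4 * N + (K.+1 * K.+1 + K) * B)) C
    (stages f m).
Proof.
elim: e f m C => [|e IH] [|f] m C // ef m0 mN exl cap.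
  apply: (winsn_le (leq_addl _ _)).
  by rewrite expn0 muln1 in mN exl cap *; apply: winsn_settle_live exl cap.
have mm' : m.*2 <= m * 2 ^ e.+1.
  by rewrite -muln2 leq_mul2l expnS leq_pmulr ?orbT // expn_gt0.
have [/existsP exl'|/existsPn nl] := boolP [exists i, live (take m l) i].
  apply: (winsn_le (leq_addl _ _)).
  by apply: winsn_settle_live mN _ cap => //; lia.
have km : k <= N %/ m by rewrite leq_divRL //; nia.
have dE : m * 2 ^ e.+1 = m.*2 * 2 ^ e by rewrite expnS -muln2 mulnA.
rewrite dE in mm' mN exl cap *.
apply: (@winsn_le (k.+1 * size (take m l) +
  (2 * k * (m.*2 * 2 ^ e - m.*2) + (4 * N + (K.+1 * K.+1 + K) * B)))).
  have szm := leq_mul (leqnn k.+1) (size_take_le m).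
  rewrite addnA leq_add2r; apply: leq_trans (leq_add szm (leqnn _)) _.
  have -> : m.*2 * 2 ^ e - m = m + (m.*2 * 2 ^ e - m.*2) by lia.
  rewrite mulnDr leq_add2r leq_mul2r; apply/orP; right; lia.
by apply: winsn_settle_no => // C'; apply: IH => //; lia.
Qed.

End Stages.
End Dynamics.

(** * Counting hash functions *)

Lemma card_dffun_family (A : finType) (rT : A -> finType)
    (F : forall a, {set rT a}) :
  #|[set f : {dffun forall a, rT a} | [forall a, f a \in F a]]|
    = \prod_a #|F a|.
Proof.
have -> : \prod_a #|F a| = foldr muln 1 [seq #|F a| | a : A].
  by rewrite foldrE big_map big_enum.
rewrite -(card_family (fun a => mem (F a))); apply: eq_card => f.
by rewrite inE; apply: eq_forallb.
Qed.

Lemma card_dffun_prod (A : finType) (rT : A -> finType) :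
  #|{dffun forall a, rT a}| = \prod_a #|rT a|.
Proof. by rewrite card_dep_ffun foldrE big_map big_enum. Qed.

Lemma card_dffun_coord (A : finType) (rT : A -> finType) (a : A)
    (E : {set rT a}) :
  #|[set f : {dffun forall a, rT a} | f a \in E]| * #|rT a|
    = #|E| * #|{dffun forall a, rT a}|.
Proof.
(* [E] at the coordinate [a] and no constraint elsewhere; the cast is needed because the type of a
   coordinate depends on its index. *)
pose F a' : {set rT a'} :=
  if a =P a' is ReflectT e then ecast z {set rT z} e E else setT.
have Fa : F a = E by rewrite /F; case: eqP => // e; rewrite (eq_axiomK e).
have Fa' a' : a' != a -> F a' = setT by move=> /eqP ne; rewrite /F; case: eqP => // e; case: (ne (esym e)).
have -> : [set f : {dffun forall a, rT a} | f a \in E]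
    = [set f : {dffun forall a, rT a} | [forall a, f a \in F a]].
  apply/setP => f; rewrite !inE; apply/idP/forallP => [fE a'|/(_ a)]; last by rewrite Fa.
  by have [->|/Fa' ->] := eqVneq a' a; rewrite ?Fa ?inE.
rewrite card_dffun_family card_dffun_prod.
rewrite (bigD1 a) //= [in RHS](bigD1 a) //= Fa.
have -> : \prod_(i | i != a) #|F i| = \prod_(i | i != a) #|rT i|.
  by apply: eq_bigr => i /Fa' ->; rewrite cardsT.
by rewrite -mulnA; congr (_ * _); rewrite mulnC.
Qed.

(** * Factorial and binomial estimates *)

Lemma expn_le_ffact n m : n ^ m <= (n + m) ^_ m.
Proof. by elim: m => // m IH; rewrite addnS ffactSS expnS leq_mul // leqW ?leq_addr. Qed.

Lemma ffact_le_expn n m : n ^_ m <= n ^ m.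
Proof.
elim: m n => // m IH n; rewrite ffactnS expnS leq_mul2l; apply/orP; right.
by apply: leq_trans (IH _) _; case: m {IH} => // m; rewrite leq_exp2r ?leq_pred.
Qed.

Lemma bin_le_exp2 n m : 'C(n, m) <= 2 ^ n.
Proof.
elim: n m => [|n IH] [|m]; rewrite ?bin0 ?expn_gt0 // binS expnS.
by have := IH m; have := IH m.+1; lia.
Qed.

(** A weak Stirling bound: the falling factorial of [2 * t] of length [t] is a central binomial
    coefficient times the factorial of [t]. *)
Lemma expnn_le_fact t : t ^ t <= 4 ^ t * t`!.
Proof.
apply: leq_trans (expn_le_ffact t t) _.
by rewrite -bin_ffact leq_mul2r (_ : 4 = 2 ^ 2) // -expnM mul2n -addnn bin_le_exp2 orbT.
Qed.

(** Union bound in integer form: [mu] uniform values among [r] all lie in some set of size [t] with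
    probability at most [2 ^ - mu]. With [mu = 2 * t + u], the leftover factor [4 ^ t * 2 ^ mu] is
    absorbed by [16 ^ (t + u)]. *)
Lemma bin_expn_bound (r t mu : nat) : 0 < mu -> 16 * t <= r -> 2 * t <= mu ->
  'C(r, t) * t ^ mu * 2 ^ mu <= r ^ mu.
Proof.
move=> mu0 tr tmu; case: t => [|t] in tr tmu *; first by rewrite exp0n // muln0.
set s := t.+1 in tr tmu *; rewrite -(leq_pmul2r (fact_gt0 s)).
have [u mE] : exists u, mu = s + (s + u) by exists (mu - (s + s)); lia.
have -> : 'C(r, s) * s ^ mu * 2 ^ mu * s`! = r ^_ s * (s ^ mu * 2 ^ mu).
  by rewrite -bin_ffact; ring.
apply: leq_trans (leq_mul (ffact_le_expn _ _) (leqnn _)) _.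
have -> : s ^ mu = s ^ s * s ^ (s + u) by rewrite mE expnD.
have -> : r ^ s * (s ^ s * s ^ (s + u) * 2 ^ mu)
          = (r ^ s * s ^ (s + u) * 2 ^ mu) * s ^ s by ring.
apply: leq_trans (leq_mul (leqnn _) (expnn_le_fact s)) _.
rewrite mulnA leq_mul2r; apply/orP; right.
have -> : r ^ mu = r ^ s * r ^ (s + u) by rewrite mE expnD.
rewrite -!mulnA leq_mul2l; apply/orP; right.
apply: (@leq_trans ((16 * s) ^ (s + u))); last by rewrite leq_exp2r //; lia.
rewrite expnMn mulnC leq_mul2r; apply/orP; right.
rewrite (_ : 16 = 2 ^ 4) // -(expnM 2 2 s) -expnM -expnD leq_exp2l //; lia.
Qed.

Lemma superset_of_card (T : finType) (A : {set T}) t :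
  #|A| <= t -> t <= #|T| -> exists2 B : {set T}, A \subset B & #|B| = t.
Proof.
elim: t => [|t IH]; first by rewrite leqn0 => /eqP e _; exists A.
rewrite leq_eqVlt => /orP[/eqP e _|At tT]; first by exists A.
have [B AB Bt] := IH At (ltnW tT).
have /card_gt0P[y] : 0 < #|~: B| by have := cardsC B; lia.
rewrite inE => yB; exists (y |: B); last by rewrite cardsU1 yB Bt.
by apply: subset_trans AB (subsetUr _ _).
Qed.

Lemma card_bigcup_le (T J : finType) (D : {set J}) (F : J -> {set T}) :
  #|\bigcup_(j in D) F j| <= \sum_(j in D) #|F j|.
Proof.
elim/big_rec2: _ => [|j m A _ IH]; first by rewrite cards0.
by apply: leq_trans (leq_card_setU _ _) _; rewrite leq_add2l.
Qed.

(** * Random images of a query set, and resampling of stored hash values *)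

Section Hashing.
Variables (U : finType) (n k : nat) (len : 'I_k -> nat) (x : 'I_n -> U).
Variable Q : {set U}.
Hypotheses (x_inj : injective x) (Qx : forall i, x i \notin Q).
Local Notation H := (hash_family U len).
Local Notation T b := ((len b).-tuple bool).
Local Notation Y := {dffun forall b, T b}.
Local Notation V := {ffun 'I_n -> Y}.
Implicit Types (h : H) (v : V) (b : 'I_k) (i : 'I_n).

Definition hash_image h b : {set T b} := [set h b q | q in Q].

(** A stored element is live exactly when its tuple of hash values falls into this product of
    images. *)
Definition covered h : {set Y} := [set y : Y | [forall b, y b \in hash_image h b]].

Definition values h i : Y := finfun (fun b => h b (x i)).

Definition uncovered h : bool := [forall i, values h i \notin covered h].

Definition num_covered h : nat := #|[set i | values h i \in covered h]|.

Definition restr h : V := [ffun i => values h i].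

Definition override h v : H :=
  finfun (fun b => [ffun u => if [pick i | x i == u] is Some i then v i b else h b u]).

Lemma override_in h v i b : override h v b (x i) = v i b.
Proof.
rewrite /override !ffunE; case: pickP => [j /eqP/x_inj -> //|/(_ i)].
by rewrite eqxx.
Qed.

Lemma override_out h v b u : (forall i, x i != u) -> override h v b u = h b u.
Proof.
move=> ne; rewrite /override !ffunE; case: pickP => // j.
by rewrite (negPf (ne j)).
Qed.

Lemma values_override h v i : values (override h v) i = v i.
Proof. by apply/ffunP => b; rewrite ffunE override_in. Qed.

Lemma override_invol h v :
  (override (override h v) (restr h) = h) * (restr (override h v) = v).
Proof.
split; last by apply/ffunP => i; rewrite ffunE values_override.
apply/ffunP => b; apply/ffunP => u.
have [/existsP[i /eqP <-]|/existsPn ne] := boolP [exists i, x i == u].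
  by rewrite override_in !ffunE.
by rewrite !override_out.
Qed.

Lemma hash_image_override h v b : hash_image (override h v) b = hash_image h b.
Proof.
apply: eq_in_imset => q qQ; rewrite override_out // => i.
by apply: contraNneq (Qx i) => ->.
Qed.

Lemma covered_override h v : covered (override h v) = covered h.
Proof.
by apply/setP => y; rewrite !inE; apply: eq_forallb => b; rewrite hash_image_override.
Qed.

(* Resampling the hash values of the stored elements preserves the uniform
   distribution, since [(h, v) |-> (override h v, restr h)] is an involution. *)
Lemma sum_override (f : H -> nat) :
  (\sum_h f h) * #|V| = \sum_h \sum_v f (override h v).
Proof.
rewrite pair_big /= mulnC.
pose phi (p : H * V) := (override p.1 p.2, restr p.1).
have phiK : involutive phi by case=> h v; rewrite /phi /= !override_invol.
rewrite [RHS](reindex_inj (inv_inj phiK)) /phi /=.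
rewrite [RHS](eq_bigr (fun p => f p.1)); last by move=> p _; rewrite override_invol.
rewrite -(pair_big xpredT xpredT (fun h _ => f h)) /= big_distrr /=.
by apply: eq_bigr => h _; rewrite sum_nat_const.
Qed.

Lemma card_covered h : #|covered h| = \prod_b #|hash_image h b|.
Proof. exact: card_dffun_family. Qed.

Lemma card_hash_values : #|{: Y}| = \prod_b 2 ^ len b.
Proof.
by rewrite card_dffun_prod; apply: eq_bigr => b _; rewrite card_tuple card_bool.
Qed.

(** The values of [h b] on [Q] are independent and uniform, so the probability is
    [(#|A| / 2 ^ len b) ^ #|Q|], stated without division. *)
Lemma card_hash_image_sub b (A : {set T b}) :
  #|[set h : H | hash_image h b \subset A]| * (2 ^ len b) ^ #|Q|
    = #|A| ^ #|Q| * #|{: H}|.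
Proof.
pose F := [set f : {ffun U -> T b} | [forall q, f q \in if q \in Q then A else setT]].
have -> : [set h : H | hash_image h b \subset A] = [set h : H | h b \in F].
  apply/setP => h; rewrite !inE; apply/subsetP/forallP => [sA q|hA t].
    by case: ifP => // qQ; rewrite ?inE //; apply/sA/imset_f.
  by case/imsetP => q qQ ->; move: (hA q); rewrite qQ.
have := @card_dffun_coord _ (fun b => {ffun U -> T b} : finType) b F.
have cF : #|F| * (2 ^ len b) ^ #|Q| = #|A| ^ #|Q| * #|{: {ffun U -> T b}}|.
  have := @card_dffun_family U (fun=> T b) (fun q => if q \in Q then A else setT).
  rewrite -/F => ->.
  rewrite card_ffun card_tuple card_bool (bigID (mem Q)) /=.
  rewrite (eq_bigr (fun=> #|A|)); last by move=> q ->.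
  rewrite [X in _ * X * _](eq_bigr (fun=> 2 ^ len b)); last first.
    by move=> q /negPf ->; rewrite cardsT card_tuple card_bool.
  rewrite !prod_nat_const -mulnA -expnD; congr (_ * (_ ^ _)).
  by rewrite -(cardC (mem Q)) addnC.
move=> cH; have c0 : 0 < #|{: {ffun U -> T b}}|.
  by rewrite card_ffun card_tuple card_bool !expn_gt0.
apply/eqP; rewrite -(eqn_pmul2r c0) -mulnAC cH mulnAC cF; apply/eqP; ring.
Qed.

(** Union bound over the sets of size [t] that can contain the image. *)
Lemma card_hash_image_small b t : 16 * t <= 2 ^ len b -> 2 * t <= #|Q| -> 0 < #|Q| ->
  #|[set h : H | #|hash_image h b| <= t]| * 2 ^ #|Q| <= #|{: H}|.
Proof.
move=> tb tQ Q0; have R0 : 0 < (2 ^ len b) ^ #|Q| by rewrite !expn_gt0.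
rewrite -(leq_pmul2r R0).
pose D := [set A : {set T b} | #|A| == t].
have -> : #|[set h : H | #|hash_image h b| <= t]| * 2 ^ #|Q| * (2 ^ len b) ^ #|Q| =
   #|[set h : H | #|hash_image h b| <= t]| * (2 ^ len b) ^ #|Q| * 2 ^ #|Q| by ring.
have sub : [set h : H | #|hash_image h b| <= t] \subset
    \bigcup_(A in D) [set h : H | hash_image h b \subset A].
  apply/subsetP => h; rewrite inE => ht.
  have [A] : exists2 A : {set T b}, hash_image h b \subset A & #|A| = t.
    have tT : t <= #|{: T b}| by rewrite card_tuple card_bool; lia.
    exact: superset_of_card.
  by move=> sA cA; apply/bigcupP; exists A; rewrite inE ?cA ?sA.
have le1 : #|[set h : H | #|hash_image h b| <= t]| * (2 ^ len b) ^ #|Q| <=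
    'C(2 ^ len b, t) * t ^ #|Q| * #|{: H}|.
  apply: leq_trans (leq_mul (subset_leq_card sub) (leqnn _)) _.
  apply: leq_trans (leq_mul (card_bigcup_le _ _) (leqnn _)) _.
  rewrite big_distrl /= (eq_bigr (fun=> t ^ #|Q| * #|{: H}|)).
    by rewrite sum_nat_const card_draws card_tuple card_bool mulnA.
  by move=> A; rewrite inE card_hash_image_sub => /eqP ->.
apply: leq_trans (leq_mul le1 (leqnn _)) _.
have := bin_expn_bound Q0 tb tQ; set X := 'C(_, _) * _ => bb.
by rewrite -mulnA [#|_| * 2 ^ _]mulnC mulnA mulnC leq_mul2l bb orbT.
Qed.

Lemma card_uncovered h :
  #|[set v : V | [forall i, v i \notin covered h]]|
    = (#|{: Y}| - #|covered h|) ^ n.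
Proof.
have -> : #|{: Y}| - #|covered h| = #|~: covered h| by rewrite [RHS]cardsCs setCK.
have := @card_dffun_family 'I_n (fun=> Y) (fun=> ~: covered h).
rewrite prod_nat_const card_ord => <-.
by apply: eq_card => v; rewrite !inE; apply: eq_forallb => i; rewrite !inE.
Qed.

(** Linearity of expectation: each stored element is covered with probability
    [#|covered h| / #|Y|]. *)
Lemma sum_covered h :
  (\sum_(v : V) #|[set i | v i \in covered h]|) * #|{: Y}|
    = n * #|covered h| * #|V|.
Proof.
have -> : \sum_(v : V) #|[set i | v i \in covered h]|
    = \sum_i #|[set v : V | v i \in covered h]|.
  transitivity (\sum_(v : V) \sum_i (v i \in covered h : nat)).
    apply: eq_bigr => v _; rewrite -sum1_card big_mkcond /=.
    by apply: eq_bigr => i _; rewrite inE; case: ifP.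
  rewrite exchange_big /=; apply: eq_bigr => i _.
  rewrite -sum1_card [RHS]big_mkcond /=.
  by apply: eq_bigr => v _; rewrite !inE.
rewrite big_distrl /= (eq_bigr (fun=> #|covered h| * #|V|)).
  by rewrite sum_nat_const card_ord mulnA.
by move=> i _; apply: (@card_dffun_coord 'I_n (fun=> Y) i (covered h)).
Qed.

End Hashing.

(** * The adversary *)

(** When the budget is exhausted the pending query is named, an arbitrary choice of leaf. *)
Fixpoint truncate (U : Type) (a : nat) (t : strategy U) : strategy U :=
  match t, a with
  | Query q next, a'.+1 => Query q (fun r => truncate a' (next r))
  | Query q _, 0 => Name q
  | Name q, _ => Name q
  end.

Lemma num_queries_truncate (U : Type) a (t : strategy U) :
  num_queries (truncate a t) <= a.
Proof.
elim: t a => [q|q next IH] [|a] //=.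
by rewrite ltnS geq_max !IH.
Qed.

(** * From the filter to the abstract dynamics *)

Section Semantics.
Variables (U : finType) (n k : nat) (len : 'I_k -> nat).
Variables (h : hash_family U len) (x : 'I_n -> U).

(** Queries to stored elements never move anything, so they count as hitting nothing. *)
Definition hits i b q : bool := (q \notin codom x) && (h b q == h b (x i)).

Lemma notin_codom q : (q \notin codom x) = [forall i, q != x i].
Proof.
apply/idP/forallP => [nq i|ne]; last first.
  by apply/negP => /codomP[i e]; have := ne i; rewrite e eqxx.
by apply: contra nq => /eqP ->; apply: codom_f.
Qed.

Lemma false_positiveE (C : configuration n k) q :
  false_positive h x C q = fp hits C q.
Proof.
rewrite /false_positive /fp -notin_codom /present /hits.
case: (q \notin codom x) => //=.
by apply/esym/existsP => -[].
Qed.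

Lemma next_configE (C : configuration n k) q : next_config h x C q = nxt hits C q.
Proof.
rewrite /next_config false_positiveE; case: ifPn => [|/existsPn nf].
  case/existsP=> i0 /andP[qx _]; apply/ffunP => i.
  by rewrite !ffunE /step /hits qx /= /collides.
by apply/ffunP => i; rewrite ffunE /step (negPf (nf i)).
Qed.

Lemma wins_truncate a C t : winsn hits a C t -> wins h x C (truncate a t).
Proof.
elim: t a C => [q|q next IH] [|a] C //=; rewrite ?false_positiveE //.
by move=> w; rewrite next_configE; apply: IH.
Qed.

Lemma live_covered P i :
  live hits P i = (values x h i \in covered [set q in P | q \notin codom x] h).
Proof.
rewrite inE; apply: eq_forallb => b; rewrite ffunE.
apply/hasP/imsetP => [[q qP /andP[qx /eqP e]]|[q + e]].
  by exists q; rewrite ?e // inE qP.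
by rewrite inE => /andP[qP qx]; exists q; rewrite // /hits qx e eqxx.
Qed.

Lemma card_live P :
  #|live hits P| = num_covered x [set q in P | q \notin codom x] h.
Proof. by apply: eq_card => i; rewrite [RHS]in_set -live_covered. Qed.

End Semantics.

(** * The attack and its random starting point *)

Section Attack.
Variables (d n : nat) (U : finType).

Definition depth : nat := trunc_log 2 n.

Definition base : nat := n %/ depth ^ 2.

(* The starting point w is random because the stored set may contain any fixed
   list of n elements, and queries to stored elements are wasted. *)
Definition pool (w : U) : seq U := rot (index w (enum U)) (enum U).

(* The number n of stages is only fuel; the truncation bounds the queries. *)
Definition attack (w : U) : strategy U :=
  truncate ((96 * d + 5) * n)
    (stages (pool w) w depth base (16 * d * n) n base).

Definition fresh (x : 'I_n -> U) (m : nat) (w : U) : {set U} :=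
  [set q in take m (pool w) | q \notin codom x].

(** The budget splits into [32 * d * n] for failed stages, [64 * d * n] for settling and collecting
    at the successful one, and [5 * n] for the bisection. *)
Lemma attack_wins k (len : 'I_k -> nat) (h : hash_family U len) x C w e :
  0 < k -> k <= depth -> 0 < base -> e < n -> base * 2 ^ e * k <= 16 * d * n ->
  ~~ uncovered x (fresh x (base * 2 ^ e) w) h ->
  e = 0 \/ num_covered x (fresh x (base * 2 ^ e) w) h * k <= base ->
  wins h x C (attack w).
Proof.
move=> k0 kK B0 en mN nu cap; apply: wins_truncate.
have K0 : 0 < depth by lia.
have n0 : 0 < n by lia.
have SB : (depth.+1 * depth.+1 + depth) * base <= 5 * n.
  have : depth ^ 2 * base <= n by rewrite mulnC leq_divM.
  have : (depth.+1 * depth.+1 + depth) <= 5 * depth ^ 2 by nia.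
  by move=> h1 h2; apply: leq_trans (leq_mul h1 (leqnn _)) _; rewrite -mulnA leq_mul2l h2.
have BK : base < 2 ^ depth.+1.
  by apply: leq_ltn_trans (leq_div _ _) _; apply: trunc_log_ltn.
apply: winsn_le (winsn_stages _ k0 kK BK (e := e) _ en B0 mN _ _).
- have : k * (base * 2 ^ e - base) <= 16 * d * n.
    by apply: leq_trans mN; rewrite mulnC leq_mul2r leq_subr orbT.
  by rewrite mulnDl; lia.
- move: nu; rewrite /uncovered => /forallPn[i]; rewrite negbK => cov; exists i.
  by rewrite live_covered.
- case: cap => [->|cap]; first by left; rewrite muln1.
  by right; rewrite card_live.
Qed.

Lemma nth_rot (T : eqType) (x0 : T) (s : seq T) r j : r < size s -> j < size s ->
  nth x0 (rot r s) j = nth x0 s ((r + j) %% size s).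
Proof.
move=> rs js; rewrite /rot nth_cat size_drop nth_drop.
case: ltnP => jr; first by rewrite modn_small //; lia.
rewrite nth_take; last by lia.
by rewrite (_ : r + j = j - (size s - r) + size s) ?modnDr ?modn_small //; lia.
Qed.

(** The position of [q] in the pool, one of [m] values, determines the starting point cyclically. *)
Lemma card_pool_mem (q : U) m : m <= #|U| -> #|[set w | q \in take m (pool w)]| <= m.
Proof.
move=> mU; set E := enum U; have szE : size E = #|U| by rewrite -cardE.
have iE w : index w E < #|U| by rewrite -szE index_mem mem_enum.
pose f (j : 'I_m) := nth q E ((index q E + (#|U| - j)) %% #|U|).
suff sub : [set w | q \in take m (pool w)] \subset [set f j | j : 'I_m].
  apply: leq_trans (subset_leq_card sub) _.
  by apply: leq_trans (leq_imset_card _ _) _; rewrite card_ord.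
apply/subsetP => w; rewrite inE => qw; set r := index w E.
have szP : size (pool w) = #|U| by rewrite size_rot.
have jm : index q (take m (pool w)) < m.
  by move: qw; rewrite -index_mem size_takel // szP.
apply/imsetP; exists (Ordinal jm) => //; rewrite /f /=.
move: (index q _) (nth_index q qw) jm => j qj jm.
have ju : j < #|U| by lia.
have e1 : nth q E ((r + j) %% #|U|) = q.
  by rewrite -[RHS]qj nth_take // /pool nth_rot -/E szE.
have -> : index q E = (r + j) %% #|U|.
  rewrite -[in LHS]e1 index_uniq ?enum_uniq // szE ltn_mod; lia.
rewrite modnDml -addnA subnKC ?(ltnW ju) // modnDr modn_small ?iE //.
by rewrite nth_index ?mem_enum.
Qed.

Lemma sum_pool (x : 'I_n -> U) m : m <= #|U| ->
  \sum_w #|[set q in take m (pool w) | q \in codom x]| <= m * n.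
Proof.
move=> mU.
have -> : \sum_w #|[set q in take m (pool w) | q \in codom x]| =
    \sum_(q in codom x) #|[set w | q \in take m (pool w)]|.
  transitivity (\sum_w \sum_(q in codom x) (q \in take m (pool w) : nat)).
    apply: eq_bigr => w _; rewrite -sum1_card [LHS]big_mkcond [RHS]big_mkcond /=.
    by apply: eq_bigr => q _; rewrite inE andbC; do 2!case: (q \in _).
  rewrite exchange_big /=; apply: eq_bigr => q _.
  by rewrite -sum1_card [RHS]big_mkcond; apply: eq_bigr => w _; rewrite inE; case: ifP.
apply: (@leq_trans (\sum_(q in codom x) m)).
  by apply: leq_sum => q _; apply: card_pool_mem.
rewrite sum_nat_const mulnC leq_mul2l; apply/orP; right.
by apply: leq_trans (card_size _) _; rewrite size_codom card_ord.
Qed.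

Definition good_start (x : 'I_n -> U) (m : nat) : {set U} :=
  [set w | m <= 2 * #|fresh x m w|].

(** Markov's inequality: a bad start has more than [m / 2] stored elements in its pool, so by
    [sum_pool] there are at most [2 * n] bad starts. *)
Lemma card_good_start (x : 'I_n -> U) m : 0 < m -> m <= #|U| -> 4 * n <= #|U| ->
  #|U| <= 2 * #|good_start x m|.
Proof.
move=> m0 mU nU.
have bad : #|~: good_start x m| * m <= 2 * (m * n).
  apply: leq_trans (leq_mul (leqnn 2) (sum_pool x mU)).
  rewrite big_distrr -sum_nat_const /= [leqRHS](bigID (mem (~: good_start x m))) /=.
  apply: leq_trans (leq_addr _ _); apply: leq_sum => w.
  rewrite !inE -ltnNge /fresh => lt.
  have := cardsID [set q | q \in codom x] [set q in take m (pool w)].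
  have -> : #|[set q in take m (pool w)]| = m.
    rewrite cardsE (card_uniqP _) ?take_uniq ?rot_uniq ?enum_uniq //.
    by rewrite size_takel // size_rot -cardE.
  have -> : [set q in take m (pool w)] :&: [set q | q \in codom x]
    = [set q in take m (pool w) | q \in codom x] by apply/setP => q; rewrite !inE.
  have -> : [set q in take m (pool w)] :\: [set q | q \in codom x]
    = [set q in take m (pool w) | q \notin codom x].
    by apply/setP => q; rewrite !inE andbC.
  have aux (a b c : nat) : 2 * b < c -> a + b = c -> c <= 2 * a by lia.
  exact: aux lt.
have : #|~: good_start x m| <= 2 * n.
  by rewrite -(leq_pmul2r m0); lia.
by have := cardsC (good_start x m); lia.
Qed.

Lemma card_fresh_le (x : 'I_n -> U) m w : #|fresh x m w| <= m.
Proof.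
have sub : fresh x m w \subset take m (pool w).
  by apply/subsetP => q; rewrite inE => /andP[].
apply: leq_trans (subset_leq_card sub) (leq_trans (card_size _) _).
by rewrite size_take; case: ltnP.
Qed.

End Attack.

Lemma exp2_ge_sixth_power L : 2 ^ 6 <= L -> 2 ^ 10 * L ^ 6 <= 2 ^ L.
Proof.
move=> L64; rewrite -(subnKC L64); elim: (L - _) => [|j IH].
  by rewrite addn0 -expnM -expnD; apply: leq_pexp2l.
rewrite addnS [leqRHS]expnS; apply: leq_trans (leq_mul (leqnn 2) IH).
have : 2 ^ 6 <= 2 ^ 6 + j by apply: leq_addr.
move: (2 ^ 6 + j) => l l64.
rewrite mulnCA leq_mul2l; apply/orP; right.
(* Cubing gives a growth factor of at most [125 / 64 < 2] for the sixth power. *)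
have sq : 4 * l.+1 ^ 2 <= 5 * l ^ 2 by rewrite !expnS !expn0; nia.
have h : (4 * l.+1 ^ 2) ^ 3 <= (5 * l ^ 2) ^ 3 by rewrite leq_exp2r.
rewrite (expnMn 4) (expnMn 5) -!expnM in h.
rewrite -(leq_pmul2l (isT : 0 < 4 ^ 3)); apply: leq_trans h _.
by rewrite mulnA leq_mul2r; apply/orP; right.
Qed.

(** * Integer estimates for large [n] *)

Section NatEstimates.
Variables (d n k : nat).
Local Notation L := (depth n).
Hypotheses (d0 : 0 < d) (nL : 2 ^ (512 * d + 64) <= n) (k0 : 0 < k).
Hypothesis Lk : L ^ (6 * k) <= n.

Lemma depth_large : 512 * d + 64 <= L.
Proof. exact: trunc_log_max. Qed.

Lemma exp2_depth : 2 ^ L <= n < 2 ^ L.+1.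
Proof.
have n0 : 0 < n by apply: leq_trans nL; rewrite expn_gt0.
by rewrite trunc_logP // trunc_log_ltn.
Qed.

Lemma sixth_power_le : 2 ^ 10 * L ^ 6 <= n.
Proof.
have /andP[h _] := exp2_depth; apply: leq_trans h.
by apply: exp2_ge_sixth_power; have := depth_large; rewrite (_ : 2 ^ 6 = 64) //; lia.
Qed.

Lemma k_le_depth : k <= L.
Proof.
have /andP[_ h] := exp2_depth; have := depth_large => dl.
have : 2 ^ (6 * k) < 2 ^ L.+1.
  apply: leq_ltn_trans h; apply: leq_trans Lk; rewrite leq_exp2r; lia.
rewrite ltn_exp2l //; lia.
Qed.

Lemma base_large : 2 ^ 10 * L ^ 4 <= base n.
Proof.
have dl := depth_large.
rewrite leq_divRL ?expn_gt0; last by apply/orP; left; lia.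
by rewrite -mulnA -expnD; apply: sixth_power_le.
Qed.

Lemma k_le_base : 16 * k <= base n.
Proof.
have dl := depth_large; have kL := k_le_depth; apply: leq_trans base_large.
apply: leq_mul => //; apply: leq_trans kL _.
by rewrite -[leqLHS]expn1 leq_pexp2l //; lia.
Qed.

Lemma le_base : n <= 2 * L ^ 2 * base n.
Proof.
have dl := depth_large; have L2 : 0 < L ^ 2 by rewrite expn_gt0; apply/orP; left; lia.
have B0 : 0 < base n by have := k_le_base; lia.
have := ltn_ceil n L2; rewrite -/(base n) => h.
apply: leq_trans (ltnW h) _; rewrite mulnC -mulnA mulnCA leq_mul2l; apply/orP; right.
lia.
Qed.

(** The least [e] meeting the lower bound overshoots by a factor of at most two; for [e = 0] the
    upper bound follows from [base n * k <= n]. *)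
Lemma critical_stage : exists2 e, (e < n) &
  (8 * d * n <= base n * 2 ^ e * k <= 16 * d * n).
Proof.
have dl := depth_large; have B0 : 0 < base n by have := k_le_base; lia.
have /andP[lo up] := exp2_depth.
have big : 8 * d * n <= base n * 2 ^ (2 * L + 2) * k.
  apply: (@leq_trans (n * n)).
    rewrite leq_mul2r; apply/orP; right; apply: leq_trans lo.
    by apply: leq_trans (ltnW (ltn_expl _ _)) => //; lia.
  apply: (@leq_trans (2 ^ L.+1 * 2 ^ L.+1)); first by rewrite leq_mul // ltnW.
  rewrite -expnD (_ : L.+1 + L.+1 = 2 * L + 2); last by lia.
  by rewrite -mulnA mulnCA leq_pmulr // muln_gt0 B0.
have exP : exists e, 8 * d * n <= base n * 2 ^ e * k by exists (2 * L + 2).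
have [e he emin] := ex_minnP exP; exists e.
  apply: leq_ltn_trans (emin _ big) _; apply: leq_trans sixth_power_le.
  have : L * 1 <= L * L ^ 5 by rewrite leq_mul2l expn_gt0; apply/orP; right; lia.
  by rewrite -expnS; lia.
rewrite he /=; case: e he emin => [|e] he emin.
  rewrite expn0 muln1 in he *.
  have : base n * k <= n.
    have := leq_divM n (L ^ 2); rewrite -/(base n) => h; apply: leq_trans h.
    rewrite leq_mul2l; apply/orP; right; apply: leq_trans k_le_depth _.
    by rewrite -[leqLHS]expn1 leq_pexp2l //; lia.
  by nia.
have : ~~ (8 * d * n <= base n * 2 ^ e * k) by apply/negP => /emin; rewrite ltnn.
by rewrite -ltnNge expnS; lia.
Qed.

(** Since [512 * d <= L], the left side is at most [32 * L ^ 3 * L ^ (3 * k)], whose square is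
    bounded by [sixth_power_le] times [Lk]. *)
Lemma slack : 32 * L ^ 3 * (512 * d * L ^ 2) ^ k <= n.
Proof.
have dl := depth_large.
apply: (@leq_trans (32 * L ^ 3 * L ^ (3 * k))).
  rewrite leq_mul2l; apply/orP; right.
  rewrite expnM leq_exp2r // expnS leq_mul2r; apply/orP; right; lia.
rewrite -(leq_exp2r _ _ (isT : 0 < 2)) [leqRHS]expnS expn1.
apply: leq_trans (leq_mul sixth_power_le Lk).
by rewrite !expnMn -!expnM (_ : 3 * k * 2 = 6 * k) //; lia.
Qed.

End NatEstimates.

(** * Probability estimates *)

Local Open Scope ring_scope.

Local Open Scope ring_scope.

Lemma one_sub_expn_le (R : realFieldType) (p : R) n : 0 <= p <= 1 ->
  (1 - p) ^+ n <= (1 + n%:R * p)^-1.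
Proof.
move=> /andP[p0 p1]; have pos m : 0 < 1 + m%:R * p by rewrite ltr_wpDr ?mulr_ge0.
rewrite -[leRHS]mul1r ler_pdivlMr //; elim: n => [|n IH].
  by rewrite expr0 mul0r addr0 mulr1.
apply: le_trans IH; rewrite exprSr -mulrA ler_wpM2l ?exprn_ge0 ?subr_ge0 //.
have : 0 <= p * p by rewrite mulr_ge0.
have : 0 <= n%:R * (p * p) by rewrite !mulr_ge0.
rewrite -addn1 natrD; lra.
Qed.

(** * Probability of no live element, and of too many *)

Section HashingBounds.
Variables (R : realFieldType) (U : finType) (n k : nat) (len : 'I_k -> nat).
Variables (x : 'I_n -> U) (Q : {set U}).
Hypotheses (x_inj : injective x) (Qx : forall i, x i \notin Q) (Q0 : (0 < #|Q|)%N).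
Local Notation H := (hash_family U len).
Local Notation Y := {dffun forall b, (len b).-tuple bool}.
Local Notation V := {ffun 'I_n -> Y}.
Implicit Types (h : H) (v : V).

Definition small_size b : nat := minn (2 ^ len b %/ 16) (#|Q| %/ 2).

Definition large_images h : bool := [forall b, (small_size b < #|hash_image Q h b|)%N].

Lemma card_not_large :
  #|[set h | ~~ large_images h]|%:R <= k%:R / 2 ^+ #|Q| * #|{: H}|%:R :> R.
Proof.
rewrite mulrAC ler_pdivlMr ?exprn_gt0 // -natrX -!natrM ler_nat.
have -> : [set h | ~~ large_images h]
   = \bigcup_(b in [set: 'I_k]) [set h | (#|hash_image Q h b| <= small_size b)%N].
  apply/setP => h; rewrite !inE; apply/forallPn/bigcupP => [[b nb]|[b _ hb]].
    by exists b; rewrite !inE // leqNgt.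
  by exists b; rewrite inE leqNgt in hb.
apply: leq_trans (leq_mul (card_bigcup_le _ _) (leqnn _)) _.
rewrite big_distrl /=; apply: (@leq_trans (\sum_(b in [set: 'I_k]) #|{: H}|)%N).
  apply: leq_sum => b _; apply: card_hash_image_small => //.
    by rewrite mulnC; apply: leq_trans (leq_divM _ 16); rewrite leq_mul2r geq_minl orbT.
  by rewrite mulnC; apply: leq_trans (leq_divM _ 2); rewrite leq_mul2r geq_minr orbT.
by rewrite sum_nat_const cardsT card_ord.
Qed.

Lemma V_gt0 : (0 < #|{: V}|)%N.
Proof. by rewrite card_ffun expn_gt0 card_hash_values prodn_gt0 // => b; rewrite expn_gt0. Qed.

Lemma Y_gt0 : (0 < #|{: Y}|)%N.
Proof. by rewrite card_hash_values prodn_gt0 // => b; rewrite expn_gt0. Qed.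

Lemma covered_le_Y h : (#|covered Q h| <= #|{: Y}|)%N.
Proof. exact: max_card. Qed.

(** Either some image is small, or all [n] stored elements independently miss a set of density at
    least [p]. *)
Lemma card_uncovered_fraction (p : R) : 0 <= p <= 1 ->
  (forall h : H, large_images h -> p * #|{: Y}|%:R <= #|covered Q h|%:R) ->
  #|[set h : H | uncovered x Q h]|%:R
    <= (k%:R / 2 ^+ #|Q| + (1 + n%:R * p)^-1) * #|{: H}|%:R.
Proof.
move=> p01 hp; pose E := [set h | large_images h && uncovered x Q h].
have sub : [set h : H | uncovered x Q h] \subset [set h | ~~ large_images h] :|: E.
  by apply/subsetP => h; rewrite !inE => ->; case: large_images.
have le1 : (#|[set h : H | uncovered x Q h]| <= #|[set h | ~~ large_images h]| + #|E|)%N.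
  by apply: leq_trans (subset_leq_card sub) _; rewrite cardsU leq_subr.
apply: (@le_trans _ _ (#|[set h | ~~ large_images h]| + #|E|)%:R).
  by rewrite ler_nat.
rewrite natrD mulrDl lerD ?card_not_large //.
rewrite -(ler_pM2r (x := #|{: V}|%:R)) ?ltr0n ?V_gt0 //.
(* Averaging over resampled stored values leaves the images of [Q] fixed, so each [h] can be treated
   separately. *)
have -> : #|E|%:R * #|{: V}|%:R = \sum_h #|[set v | override x h v \in E]|%:R :> R.
  rewrite -natrM -natr_sum; congr _%:R.
  have := sum_override x_inj (fun h => (h \in E : nat)).
  have -> : (\sum_h (h \in E : nat) = #|E|)%N by rewrite -sum1_card [RHS]big_mkcond.
  move=> ->; apply: eq_bigr => h _; rewrite -sum1_card [RHS]big_mkcond /=.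
  by apply: eq_bigr => v _; rewrite !inE.
apply: (@le_trans _ _ (\sum_(h : H) (1 + n%:R * p)^-1 * #|{: V}|%:R)); last first.
  by rewrite sumr_const [leRHS]mulrAC [leRHS]mulr_natr.
apply: ler_sum => h _.
have [lg|nlg] := boolP (large_images h); last first.
  rewrite (_ : [set v | _] = set0) ?cards0; last first.
    apply/setP => v; rewrite !inE; apply/negbTE; rewrite negb_and; apply/orP; left.
    apply: contra nlg => /forallP h'; apply/forallP => b.
    by rewrite -(hash_image_override Qx h v) h'.
  rewrite mulr_ge0 // invr_ge0 addr_ge0 // mulr_ge0 //; by case/andP: p01.
have -> : #|[set v | override x h v \in E]| = #|[set v : V | [forall i, v i \notin covered Q h]]|.
  apply: eq_card => v; rewrite !inE /uncovered.
  have -> : large_images (override x h v).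
    by apply/forallP => b; rewrite hash_image_override //; apply: (forallP lg).
  by apply: eq_forallb => i; rewrite values_override // covered_override.
rewrite card_uncovered natrX natrB ?covered_le_Y //.
apply: (@le_trans _ _ (((1 - p) * #|{: Y}|%:R) ^+ n)).
  apply: lerXn2r; rewrite ?nnegrE ?subr_ge0 ?ler_nat ?covered_le_Y //.
    by rewrite mulr_ge0 // subr_ge0; case/andP: p01.
  by have := hp h lg; lra.
rewrite exprMn card_ffun card_ord natrX ler_wpM2r ?exprn_ge0 //.
exact: one_sub_expn_le.
Qed.

(** Markov's inequality for [k] times the number of covered elements. *)
Lemma card_many_covered (p : R) (B : nat) :
  (forall h, #|covered Q h|%:R <= p * #|{: Y}|%:R) ->
  #|[set h : H | (B < num_covered x Q h * k)%N]|%:R * B%:R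
    <= n%:R * k%:R * p * #|{: H}|%:R.
Proof.
move=> hp.
have mk : (#|[set h : H | (B < num_covered x Q h * k)%N]| * B <= (\sum_(h : H) num_covered x Q h) * k)%N.
  rewrite big_distrl /= -sum_nat_const big_mkcond /=; apply: leq_sum => h _.
  by rewrite inE; case: ifP => // /ltnW.
apply: (@le_trans _ _ ((\sum_(h : H) num_covered x Q h) * k)%:R); first by rewrite -natrM ler_nat.
rewrite natrM -(ler_pM2r (x := #|{: V}|%:R * #|{: Y}|%:R)); last first.
  by rewrite mulr_gt0 ?ltr0n ?V_gt0 ?Y_gt0.
have -> : (\sum_(h : H) num_covered x Q h)%:R * k%:R * (#|{: V}|%:R * #|{: Y}|%:R) =
    k%:R * ((\sum_(h : H) num_covered x Q h) * #|{: V}| * #|{: Y}|)%N%:R :> R.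
  rewrite !natrM; ring.
rewrite (sum_override x_inj) big_distrl /= natr_sum.
apply: (@le_trans _ _ (k%:R * \sum_(h : H) (n%:R * (p * #|{: Y}|%:R) * #|{: V}|%:R))).
  rewrite ler_wpM2l //; apply: ler_sum => h _.
  rewrite (eq_bigr (fun v : V => #|[set i | v i \in covered Q h]|)); last first.
    move=> v _; apply: eq_card => i.
    by rewrite [LHS]in_set [RHS]in_set values_override // covered_override.
  by rewrite sum_covered !natrM ler_wpM2r // ler_wpM2l.
rewrite sumr_const -[X in k%:R * X]mulr_natl le_eqVlt; apply/orP; left; apply/eqP; ring.
Qed.

End HashingBounds.

Local Open Scope ring_scope.

(** Guaranteed density of [covered] when all images are large and at least half of the [m] queries
    are fresh. *)
Definition lower_rate (R : realFieldType) k (len : 'I_k -> nat) (m : nat) : R :=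
  \prod_b Num.min (1 / 16) (m%:R / (4 * 2 ^+ len b)).

Definition upper_rate (R : realFieldType) k (len : 'I_k -> nat) (m : nat) : R :=
  \prod_b Num.min 1 (m%:R / 2 ^+ len b).

Section Rates.
Variables (R : realFieldType) (U : finType) (n k : nat) (len : 'I_k -> nat).
Variables (x : 'I_n -> U) (Q : {set U}) (m : nat).
Hypotheses (x_inj : injective x) (Qx : forall i, x i \notin Q).
Hypotheses (mQ : (m <= 2 * #|Q|)%N) (Qm : (#|Q| <= m)%N).
Local Notation H := (hash_family U len).
Local Notation Y := {dffun forall b, (len b).-tuple bool}.

Lemma card_Y : #|{: Y}|%:R = \prod_b 2 ^+ len b :> R.
Proof. by rewrite card_hash_values natr_prod; apply: eq_bigr => b _; rewrite natrX. Qed.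

Lemma covered_ge (h : H) : large_images Q h ->
  lower_rate R len m * #|{: Y}|%:R <= #|covered Q h|%:R.
Proof.
move=> /forallP lg; rewrite card_Y /lower_rate -big_split /= card_covered natr_prod.
apply: ler_prod => b _; have R0 : 0 < 2 ^+ len b :> R by rewrite exprn_gt0.
apply/andP; split.
  by rewrite mulr_ge0 ?exprn_ge0 // le_min !divr_ge0 // mulr_ge0 // exprn_ge0.
have := lg b; rewrite /small_size gtn_min ; set a := #|hash_image Q h b|.
rewrite !ltn_divLR // => /orP[ha|ha].
  apply: (@le_trans _ _ (1 / 16 * 2 ^+ len b)).
    by rewrite ler_wpM2r ?exprn_ge0 // ge_min lexx.
  have : (2 ^ len b)%:R <= (a * 16)%:R :> R by rewrite ler_nat ltnW.
  rewrite natrX natrM; lra.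
apply: (@le_trans _ _ (m%:R / (4 * 2 ^+ len b) * 2 ^+ len b)).
  by rewrite ler_wpM2r ?exprn_ge0 // ge_min lexx orbT.
have -> : m%:R / (4 * 2 ^+ len b) * 2 ^+ len b = m%:R / 4 :> R.
  by field; rewrite gt_eqF.
have : (m)%:R <= (2 * (a * 2))%:R :> R by rewrite ler_nat; lia.
rewrite !natrM; lra.
Qed.

Lemma covered_le (h : H) : #|covered Q h|%:R <= upper_rate R len m * #|{: Y}|%:R.
Proof.
rewrite card_Y /upper_rate -big_split /= card_covered natr_prod.
apply: ler_prod => b _; have R0 : 0 < 2 ^+ len b :> R by rewrite exprn_gt0.
rewrite ler0n /= /Num.min; case: ifP => _.
  rewrite mul1r -natrX ler_nat; apply: leq_trans (max_card _) _.
  by rewrite card_tuple card_bool.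
rewrite divfK ?gt_eqF // ler_nat; apply: leq_trans Qm; exact: leq_imset_card.
Qed.

Lemma lower_rate_bounds : 0 <= lower_rate R len m <= 1.
Proof.
rewrite prodr_ge0 /= => [|b _]; last first.
  by rewrite le_min !divr_ge0 // mulr_ge0 // exprn_ge0.
apply: prodr_ile1 => b _; apply/andP; split.
  by rewrite le_min !divr_ge0 // mulr_ge0 // exprn_ge0.
by rewrite ge_min; apply/orP; left; lra.
Qed.

Hypotheses (n0 : (0 < n)%N) (m0 : (0 < m)%N) (km : (16 * k <= m)%N).
Hypothesis lower : 2 / n%:R <= lower_rate R len m.

(** The bound is [1 / 8 + 1 / 3]: small images contribute [1 / 8] because [#|Q| >= 8 * k], and an
    expected number of covered elements of at least 2 gives [1 / 3]. *)
Lemma uncovered_fraction :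
  24 * #|[set h : H | uncovered x Q h]|%:R <= 11 * #|{: H}|%:R :> R.
Proof.
have Q0 : (0 < #|Q|)%N by lia.
have le1 := @card_uncovered_fraction R U n k len x Q x_inj Qx Q0 _
              lower_rate_bounds covered_ge.
have n0R : 0 < n%:R :> R by rewrite ltr0n.
have k8 : k%:R / 2 ^+ #|Q| <= 1 / 8 :> R.
  rewrite ler_pdivrMr ?exprn_gt0 //.
  suff : (8 * k)%:R <= (2 ^ #|Q|)%:R :> R by rewrite natrX natrM; lra.
  by rewrite ler_nat; apply: leq_trans (ltnW (ltn_expl _ _)) => //; lia.
have l3 : (1 + n%:R * lower_rate R len m)^-1 <= 1 / 3.
  rewrite ler_pdivlMr // mulrC ler_pdivrMr; last first.
    by rewrite ltr_wpDr // mulr_ge0 //; case/andP: lower_rate_bounds.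
  have : n%:R * (2 / n%:R) <= n%:R * lower_rate R len m by rewrite ler_wpM2l.
  by rewrite mulrCA divff ?gt_eqF //; lra.
have : (k%:R / 2 ^+ #|Q| + (1 + n%:R * lower_rate R len m)^-1) * #|{: H}|%:R
   <= (1 / 8 + 1 / 3) * #|{: H}|%:R by rewrite ler_wpM2r // lerD.
lra.
Qed.

Lemma many_covered_fraction (B : nat) : (0 < B)%N ->
  8 * (n%:R * k%:R * upper_rate R len m) <= B%:R ->
  8 * #|[set h : H | (B < num_covered x Q h * k)%N]|%:R <= #|{: H}|%:R :> R.
Proof.
move=> B0 hB; have B0R : 0 < B%:R :> R by rewrite ltr0n.
have le1 := @card_many_covered R U n k len x Q x_inj Qx _ B covered_le.
rewrite -(ler_pM2r B0R).
have : 8 * (n%:R * k%:R * upper_rate R len m) * #|{: H}|%:R <= B%:R * #|{: H}|%:R.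
  by rewrite ler_wpM2r.
lra.
Qed.

End Rates.

(** * Success probability from the rate bounds *)

Section Assembly.
Variables (R : realFieldType) (d n : nat) (U : finType) (k : nat).
Variables (len : 'I_k -> nat) (x : 'I_n -> U) (e : nat).
Local Notation H := (hash_family U len).
Local Notation m := (base n * 2 ^ e)%N.

(** For a good start the failures sum to at most [11 / 24 + 1 / 8], leaving [10 / 24]; at least half
    of the starts are good, and [5 / 24 >= 1 / 5]. *)
Lemma attack_fraction (C0 : H -> configuration n k) : injective x ->
  (0 < k)%N -> (k <= depth n)%N -> (16 * k <= base n)%N -> (e < n)%N ->
  (m * k <= 16 * d * n)%N -> (m <= #|U|)%N -> (4 * n <= #|U|)%N ->
  2 / n%:R <= lower_rate R len m ->
  e = 0%N \/ 8 * (n%:R * k%:R * upper_rate R len m) <= (base n)%:R ->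
  1 / 5 * #|{: U * H}|%:R <=
    #|[set wh : U * H | wins wh.2 x (C0 wh.2) (attack d n wh.1)]|%:R :> R.
Proof.
move=> x_inj k0 kK kB en mN mU nU lower upper.
have B0 : (0 < base n)%N by lia.
have n0 : (0 < n)%N by lia.
have Bm : (base n <= m)%N by rewrite leq_pmulr // expn_gt0.
have m0 : (0 < m)%N by lia.
set W := [set wh | _].
pose G w := [set h : H | wins h x (C0 h) (attack d n w)].
have perw w : w \in good_start x m -> 10 * #|{: H}|%:R <= 24 * #|G w|%:R :> R.
  rewrite inE => gw; pose Q := fresh x m w.
  have Qx i : x i \notin Q by rewrite !inE codom_f andbF.
  have Qm : (#|Q| <= m)%N by apply: card_fresh_le.
  have km : (16 * k <= m)%N by lia.
  have le1 := uncovered_fraction x_inj Qx gw Qm n0 m0 km lower.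
  pose M := [set h : H | (e != 0%N) && (base n < num_covered x Q h * k)%N].
  have leM : 8 * #|M|%:R <= #|{: H}|%:R :> R.
    case: upper => [e0|upper]; last first.
      apply: le_trans _ (many_covered_fraction x_inj Qx Qm B0 upper).
      rewrite ler_wpM2l // ler_nat; apply/subset_leq_card/subsetP => h.
      by rewrite !inE => /andP[].
    suff -> : M = set0 by rewrite cards0 mulr0.
    by apply/setP => h; rewrite !inE e0.
  have sub : ~: G w \subset [set h : H | uncovered x Q h] :|: M.
    apply/subsetP => h; rewrite !inE; apply: contraR.
    rewrite negb_or negb_and negbK -leqNgt => /andP[nu cap].
    apply: (attack_wins _ k0 kK B0 en mN nu).
    by case/orP: cap => [/eqP|]; [left|right].
  have := subset_leq_card sub; rewrite -(ler_nat R) => le2.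
  have := (leq_card_setU [set h : H | uncovered x Q h] M).1; rewrite -(ler_nat R) natrD => le3.
  have : (#|G w| + #|~: G w|)%:R = #|{: H}|%:R :> R by rewrite cardsC.
  rewrite natrD; lra.
have WE : #|W| = (\sum_w #|G w|)%N.
  have -> : (\sum_w #|G w| = \sum_w \sum_h ((w, h) \in W : nat))%N.
    apply: eq_bigr => w _; rewrite -sum1_card big_mkcond /=.
    by apply: eq_bigr => h _; rewrite !inE /=; case: ifP.
  rewrite pair_bigA /= -sum1_card big_mkcond /=.
  by apply: eq_bigr => -[w h] _ /=; case: ifP.
have le4 : 10 * #|{: H}|%:R * #|good_start x m|%:R <= 24 * #|W|%:R :> R.
  rewrite WE natr_sum mulr_sumr mulr_natr -sumr_const.
  rewrite [leRHS](bigID (mem (good_start x m))) /=.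
  apply: (le_trans (ler_sum _ perw)); rewrite lerDl sumr_ge0 // => w _.
  by rewrite mulr_ge0.
have := card_good_start x m0 mU nU; rewrite -(ler_nat R) natrM => le5.
have : 5 * #|{: H}|%:R * #|{: U}|%:R <= 5 * #|{: H}|%:R * (2 * #|good_start x m|%:R) :> R.
  by rewrite ler_wpM2l // mulr_ge0.
have : 0 <= #|W|%:R :> R by [].
rewrite card_prod natrM; nra.
Qed.
End Assembly.

Local Open Scope ring_scope.

(** * Rates at the critical and base sizes *)

Section RateEstimates.
Variables (R : realFieldType) (d n k : nat) (len : 'I_k -> nat).
Local Notation L := (depth n).

(** Every factor is at least [2 / nu], where [32 <= nu] handles the cap [1 / 16]; the product is
    then at least [2 ^ k / n]. *)
Lemma lower_rate_critical (nu : R) m : (0 < d)%N -> (0 < n)%N -> (0 < k)%N ->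
  32 <= nu -> nu ^+ k = n%:R ->
  (forall b, 2 ^+ len b * k%:R <= d%:R * n%:R * nu) -> (8 * d * n <= m * k)%N ->
  2 / n%:R <= lower_rate R len m.
Proof.
move=> d0 n0 k0 nu32 nuk lenb mk; have nu0 : 0 < nu by lra.
have [d0R n0R k0R] : [/\ 0 < d%:R :> R, 0 < n%:R :> R & 0 < k%:R :> R].
  by rewrite !ltr0n.
apply: (@le_trans _ _ ((2 / nu) ^+ k)).
  rewrite expr_div_n nuk ler_wpM2r ?invr_ge0 // -natrX ler_nat.
  by rewrite -[leqLHS]expn1 leq_exp2l.
rewrite -[X in _ ^+ X]card_ord -prodr_const; apply: ler_prod => b _.
apply/andP; split; first by rewrite divr_ge0 // ltW.
rewrite le_min; apply/andP; split.
  by rewrite ler_pdivrMr //; lra.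
have R0 : 0 < 2 ^+ len b :> R by rewrite exprn_gt0.
rewrite ler_pdivrMr // mulrAC ler_pdivlMr ?mulr_gt0 //.
rewrite -(ler_pM2r k0R).
have : (8 * d * n)%:R <= (m * k)%:R :> R by rewrite ler_nat.
rewrite !natrM => h1; have := lenb b => h2.
apply: (@le_trans _ _ (8 * d%:R * n%:R * nu)); first by nra.
by rewrite [leRHS]mulrAC ler_wpM2r // ltW.
Qed.

Lemma lower_rate_base m : (0 < base n)%N -> (base n <= m)%N ->
  ((base n)%:R / (16 * m%:R)) ^+ k * upper_rate R len m
    <= lower_rate R len (base n).
Proof.
move=> B0 Bm; have B0R : 0 < (base n)%:R :> R by rewrite ltr0n.
have m0R : 0 < m%:R :> R by rewrite ltr0n; lia.
have BmR : (base n)%:R <= m%:R :> R by rewrite ler_nat.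
rewrite -[X in _ ^+ X]card_ord -prodr_const -big_split /=; apply: ler_prod => b _.
have R0 : 0 < 2 ^+ len b :> R by rewrite exprn_gt0.
have a0 : 0 <= (base n)%:R / (16 * m%:R) :> R by rewrite divr_ge0 // mulr_ge0.
apply/andP; split; first by rewrite mulr_ge0 // le_min ler01 divr_ge0 // ltW.
rewrite le_min; apply/andP; split.
  apply: (@le_trans _ _ ((base n)%:R / (16 * m%:R) * 1)).
    by rewrite ler_wpM2l // ge_min lexx.
  by rewrite mulr1 ler_pdivrMr ?mulr_gt0 //; lra.
apply: (@le_trans _ _ ((base n)%:R / (16 * m%:R) * (m%:R / 2 ^+ len b))).
  by rewrite ler_wpM2l // ge_min lexx orbT.
have -> : (base n)%:R / (16 * m%:R) * (m%:R / 2 ^+ len b)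
   = (base n)%:R / 2 ^+ len b / 16 :> R.
  by field; rewrite !gt_eqF.
have -> : (base n)%:R / (4 * 2 ^+ len b) = (base n)%:R / 2 ^+ len b / 4 :> R.
  by field; rewrite !gt_eqF.
have : 0 <= (base n)%:R / 2 ^+ len b :> R by rewrite divr_ge0 // ltW.
lra.
Qed.

Hypotheses (d0 : (0 < d)%N) (nL : (2 ^ (512 * d + 64) <= n)%N) (k0 : (0 < k)%N).
Hypothesis Lk : (L ^ (6 * k) <= n)%N.

(* Shrinking the pool from m to the base size costs a factor of at most 512 d L^2
   per hash function, hence in total a factor that [slack] absorbs. *)
Lemma lower_or_upper m : (base n <= m)%N -> (m * k <= 16 * d * n)%N ->
  2 / n%:R <= lower_rate R len (base n) \/
  8 * (n%:R * k%:R * upper_rate R len m) <= (base n)%:R.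
Proof.
move=> Bm mk; have dl := depth_large nL.
have kL := k_le_depth d0 nL k0 Lk; have kB := k_le_base d0 nL k0 Lk.
have nB := le_base d0 nL k0 Lk; have sl := slack d0 nL k0 Lk.
have B0 : (0 < base n)%N by lia.
have n0 : (0 < n)%N by apply: leq_trans nL; rewrite expn_gt0.
have [up|lo] := lerP (8 * (n%:R * k%:R * upper_rate R len m)) (base n)%:R; [by right|left].
apply: le_trans (lower_rate_base B0 Bm).
have [n0R k0R B0R] : [/\ 0 < n%:R :> R, 0 < k%:R :> R & 0 < (base n)%:R :> R].
  by rewrite !ltr0n.
have L0R : 0 < L%:R :> R by rewrite ltr0n; lia.
have d0R : 0 < d%:R :> R by rewrite ltr0n.
have m0R : 0 < m%:R :> R by rewrite ltr0n; lia.
pose r : R := (512 * d * L ^ 2)%:R.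
have r0 : 0 < r by rewrite ltr0n muln_gt0 muln_gt0 d0 expn_gt0; lia.
(* This is [m <= 16 * d * n] combined with [n <= 2 * L ^ 2 * base n]. *)
have hr : r^-1 <= (base n)%:R / (16 * m%:R).
  rewrite ler_pdivlMr ?mulr_gt0 // mulrC ler_pdivrMr // -!natrM ler_nat.
  apply: (@leq_trans (16 * (16 * d * n))).
    by rewrite leq_mul2l; apply: leq_trans mk; rewrite leq_pmulr.
  apply: (@leq_trans (16 * (16 * d * (2 * L ^ 2 * base n)))).
    by rewrite !leq_mul2l nB !orbT.
  nia.
(* By [lo] the rate exceeds [base n / (8 * n * k)], and [n <= 2 * L ^ 2 * base n], [k <= L]. *)
have hu : (16 * L ^ 3)%:R^-1 <= upper_rate R len m.
  rewrite -[leLHS]mul1r ler_pdivrMr; last first.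
    by rewrite ltr0n muln_gt0 expn_gt0; lia.
  rewrite -(ler_pM2l B0R) mulr1; apply: ltW; apply: (lt_le_trans lo).
  have u0 : 0 <= upper_rate R len m.
    by rewrite prodr_ge0 // => b _; rewrite le_min ler01 divr_ge0 // exprn_ge0.
  have : (8 * (n * k))%:R <= (base n * (16 * L ^ 3))%:R :> R.
    rewrite ler_nat; apply: (@leq_trans (8 * (2 * L ^ 2 * base n * L))).
      by rewrite leq_mul2l leq_mul.
    by rewrite leq_eqVlt; apply/orP; left; apply/eqP; ring.
  move=> /(ler_wpM2r u0) h.
  have -> : 8 * (n%:R * k%:R * upper_rate R len m)
    = (8 * (n * k))%:R * upper_rate R len m by rewrite !natrM; ring.
  apply: le_trans h _; rewrite [(base n * _)%:R]natrM le_eqVlt.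
  by apply/orP; left; apply/eqP; ring.
apply: (@le_trans _ _ (r^-1 ^+ k * (16 * L ^ 3)%:R^-1)); last first.
  have ri0 : 0 <= r^-1 by rewrite invr_ge0 ltW.
  apply: ler_pM => //; [exact: exprn_ge0|by rewrite invr_ge0|].
  by apply: lerXn2r; rewrite ?nnegrE ?invr_ge0 ?divr_ge0 ?mulr_ge0 // ltW.
rewrite exprVn -invfM ler_pdivrMr // mulrC ler_pdivlMr; last first.
  by rewrite mulr_gt0 ?exprn_gt0 // ltr0n muln_gt0 expn_gt0; lia.
rewrite -natrX -!natrM ler_nat; apply: leq_trans sl.
by rewrite leq_eqVlt; apply/orP; left; apply/eqP; ring.
Qed.
End RateEstimates.

Local Open Scope ring_scope.

(** * From the logarithmic hypotheses to integer bounds *)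

Section RealEstimates.
Variable R : realType.

Lemma ln2_gt0 : 0 < ln 2 :> R.
Proof. by rewrite ln_gt0 // ltr1n. Qed.

Lemma depth_power_le n k : (4 < n)%N ->
  k%:R < log2 n%:R / (6 * log2 (log2 n%:R)) :> R -> (depth n ^ (6 * k) <= n)%N.
Proof.
move=> n4 hk; have l2 := ln2_gt0; have n0 : (0 < n)%N by lia.
have n0R : 0 < n%:R :> R by rewrite ltr0n.
set Lam : R := log2 n%:R in hk.
have LamE : Lam * ln 2 = ln n%:R by rewrite /Lam /log2 divfK ?gt_eqF.
have Lle : (depth n)%:R <= Lam.
  rewrite ler_pdivlMr // mulr_natl -lnXn // ler_ln ?posrE ?exprn_gt0 //.
  by rewrite -natrX ler_nat trunc_logP.
have L2 : (2 <= depth n)%N by apply: trunc_log_max => //; lia.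
have L0 : 0 < (depth n)%:R :> R by rewrite ltr0n; lia.
have Lam2 : 2 <= Lam by apply: le_trans Lle; rewrite ler_nat.
have lnLam : 0 < ln Lam by rewrite ln_gt0 //; lra.
have ll0 : 0 < log2 Lam by apply: divr_gt0.
have den0 : 0 < 6 * log2 Lam by apply: mulr_gt0.
move: hk; rewrite ltr_pdivlMr // => hk.
have h1 : (6 * k)%:R * ln Lam < ln n%:R.
  rewrite -LamE; move: hk; rewrite -(ltr_pM2r l2) => hk.
  have : log2 Lam * ln 2 = ln Lam by rewrite /log2 divfK ?gt_eqF.
  rewrite natrM; nra.
rewrite -(ler_nat R) natrX -ler_ln ?posrE ?exprn_gt0 // lnXn // -[leLHS]mulr_natl.
apply: ltW; apply: le_lt_trans h1; rewrite ler_wpM2l // ler_ln ?posrE //.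
by apply: lt_le_trans Lle.
Qed.

Lemma powR_root n k : (0 < n)%N -> (0 < k)%N ->
  (n%:R `^ (1 / k%:R)) ^+ k = n%:R :> R.
Proof.
move=> n0 k0; rewrite -powR_mulrn ?powR_ge0 // -powRrM mul1r mulVf ?powRr1 //.
by rewrite pnatr_eq0; lia.
Qed.

(** The hash range is at most [range_param F / eps], with [range_param F <= c * (n / k)] and
    [1 / eps < nu]. *)
Lemma hash_len_bound (c eps nu : R) (U : finType) n k d
    (F : adaptive_filter c U n k eps) : c <= d%:R -> (0 < n)%N -> (0 < k)%N ->
  0 < nu -> 1 / nu < eps ->
  forall b, 2 ^+ hash_len F b * k%:R <= d%:R * n%:R * nu.
Proof.
move=> cd n0 k0 nu0 heps b; have l2 := ln2_gt0.
have [n0R k0R] : 0 < n%:R :> R /\ 0 < k%:R :> R by rewrite !ltr0n.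
have nk0 : 0 < n%:R / k%:R :> R by rewrite divr_gt0.
have eps0 : 0 < eps by apply: lt_trans heps; rewrite divr_gt0.
have N0 : 0 < range_param F by apply: lt_le_trans (range_param_ge F).
have NleE : range_param F * k%:R <= d%:R * n%:R.
  rewrite -ler_pdivlMr // -mulrA; apply: le_trans (range_param_le F) _.
  by rewrite ler_wpM2r // ltW.
have R0 : 2 ^+ hash_len F b <= range_param F / eps.
  rewrite -ler_ln ?posrE ?exprn_gt0 ?divr_gt0 // lnXn // -[leLHS]mulr_natl.
  by rewrite -ler_pdivlMr //; apply: hash_len_le.
have inv : 1 <= eps * nu by rewrite -ler_pdivrMr // ltW.
apply: (@le_trans _ _ (range_param F / eps * k%:R)); first by rewrite ler_wpM2r // ltW.
rewrite mulrAC ler_pdivrMr //; apply: le_trans NleE _.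
rewrite -[leLHS]mulr1 -[leRHS]mulrA [nu * _]mulrC ler_wpM2l //.
by rewrite mulr_ge0.
Qed.

End RealEstimates.

Theorem theorem12 (R : realType) (c : R) :
  exists (A : forall (n : nat) (U : finType), adversary U)
         (a kappa n0 : nat) (delta : R),
    0 < delta /\
    forall (n : nat) (U : finType),
      (n0 <= n)%N -> (kappa * n <= #|U|)%N ->
      (forall w : coins (A n U), (num_queries (play w) <= a * n)%N) /\
      forall (k : nat) (eps : R),
        (0 < k)%N ->
        k%:R < log2 n%:R / (6 * log2 (log2 n%:R)) :> R ->
        1 / (n%:R `^ (1 / k%:R)) < eps ->
        forall (F : adaptive_filter c U n k eps) (x : 'I_n -> U),
          injective x ->
          delta <= win_probability (A n U) F x.
Proof.
have [d d0 cd] : exists2 d, (0 < d)%N & c <= d%:R.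
  exists (Num.truncn `|c|).+1 => //.
  by apply: le_trans (ler_norm c) (ltW (truncnS_gt _)).
(* The universe factor leaves room for a critical pool of at most [16 * d * n] elements and for the
   [4 * n] that makes half of the starts good. *)
exists (fun n U => Adversary (@attack d n U)), (96 * d + 5)%N, (16 * d + 4)%N,
  (2 ^ (512 * d + 64))%N, (1 / 5); split=> [|n U nL cU]; first exact: divr_gt0.
split=> [w|k eps k0 hk heps F x x_inj]; first exact: num_queries_truncate.
have dl := depth_large nL.
have Ln : (depth n < n)%N.
  have /andP[h _] := exp2_depth nL; apply: leq_trans h; exact: ltn_expl.
have n4 : (4 < n)%N by lia.
have n0 : (0 < n)%N by lia.
have Lk := depth_power_le n4 hk.
have kL := k_le_depth d0 nL k0 Lk; have kB := k_le_base d0 nL k0 Lk.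
have [e en /andP[me em]] := critical_stage d0 nL k0 Lk.
set nu := n%:R `^ (1 / k%:R) in heps.
have nu0 : 0 < nu by rewrite powR_gt0 ?ltr0n.
have nuk : nu ^+ k = n%:R by apply: powR_root.
(* Otherwise [n < 32 ^ k <= depth n ^ (6 * k) <= n]. *)
have nu32 : 32 <= nu.
  rewrite leNgt; apply/negP => lt; have : nu ^+ k < 32 ^+ k.
    by rewrite ltr_pXn2r ?nnegrE // ltW.
  rewrite nuk -natrX ltr_nat ltnNge; apply/negP; rewrite negbK.
  apply: leq_trans Lk; rewrite expnM leq_exp2r //.
  by apply: (@leq_trans (2 ^ 6)) => //; rewrite leq_exp2r //; lia.
have lenb := hash_len_bound F cd n0 k0 nu0 heps.
have Bm : (base n <= base n * 2 ^ e)%N by rewrite leq_pmulr // expn_gt0.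
have lower := lower_rate_critical d0 n0 k0 nu32 nuk lenb me.
have nU : (4 * n <= #|U|)%N by apply: leq_trans cU; rewrite mulnDl leq_addl.
have mU : (base n * 2 ^ e <= #|U|)%N.
  apply: leq_trans (leq_trans em _); first by rewrite leq_pmulr.
  by apply: leq_trans cU; rewrite mulnDl leq_addr.
pose C0 (h : hash_family U (hash_len F)) := init_config F x (fun b i => h b (x i)).
have bound : 1 / 5 * #|{: U * hash_family U (hash_len F)}|%:R <=
    #|[set wh : U * hash_family U (hash_len F)
        | wins wh.2 x (C0 wh.2) (attack d n wh.1)]|%:R :> R.
  have [low|up] := lower_or_upper R (hash_len F) d0 nL k0 Lk Bm em; last first.
    by apply: (attack_fraction C0 x_inj k0 kL kB en em mU nU lower); right.
  have low0 : 2 / n%:R <= lower_rate R (hash_len F) (base n * 2 ^ 0).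
    by rewrite expn0 muln1.
  apply: (attack_fraction C0 x_inj k0 kL kB n0 _ _ nU low0); last by left.
    rewrite expn0 muln1; apply: leq_trans em; rewrite leq_mul2r Bm orbT //.
  by rewrite expn0 muln1; apply: leq_trans mU.
rewrite /win_probability ler_pdivlMr //.
rewrite ltr0n card_prod muln_gt0; apply/andP; split.
  by apply: leq_trans nU; rewrite muln_gt0.
by apply/card_gt0P; exists (finfun (fun b => [ffun=> [tuple of nseq _ false]])).
Qed.
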